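(* Let $\mathcal{M}_1,\ldots,\mathcal{M}_m$ be finite collections of absolutely continuous (finite) measures on $[0,1]$, let $n$ be a positive integer, and let $k_1,\ldots,k_m$ be positive integers with $k_1+\cdots+k_m=m+n-1$. Then there exists a partition of $[0,1]$ into $n$ intervals $I_1,\ldots,I_n$ such that, for each $i\in[m]$, at least one of the following holds: (a) $\mu\left(\bigcup_{j\text{ odd}}I_j\right)=\mu\left(\bigcup_{j\text{ even}}I_j\right)$ for all $\mu\in\mathcal{M}_i$; (b) the equality $$\mu\Big(\bigcup_{j\text{ odd}}I_j\Big)-\mu\Big(\bigcup_{j\text{ even}}I_j\Big)=\pm\max_{\mu'\in\mathcal{M}_i}\left|\mu'\Big(\bigcup_{j\text{ odd}}I_j\Big)-\mu'\Big(\bigcup_{j\text{ even}}I_j\Big)\right|$$ holds for at least $k_i$ measures $\mu\in\mathcal{M}_i$, with each of the signs $+$ and $-$ being attained by at least $\lfloor k_i/2\rfloor$ of these measures.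
   Context: Measures are absolutely continuous with respect to Lebesgue measure (not necessarily probability measures). The intervals $I_1,\ldots,I_n$ of the partition are not required to be numbered from left to right, and may be empty or degenerate; whether endpoints belong to an interval does not matter. *)

(* Defs.v *)
From HB Require Import structures.
From mathcomp Require Import all_boot all_order all_algebra.
From mathcomp Require Import all_classical all_reals all_analysis.
Set Implicit Arguments. Unset Strict Implicit. Unset Printing Implicit Defensive.
Import Order.TTheory GRing.Theory Num.Theory.
Local Open Scope classical_set_scope.
Local Open Scope ring_scope.

Definition unit_itv (R : realType) : set R := `[0%R, 1%R]%classic.

(* A (finite) absolutely continuous measure on [0,1]: a measure on the reals,
   finite on [0,1], whose restriction to [0,1] is absolutely continuous with
   respect to Lebesgue measure. Only its values on subsets of [0,1] matter. *)
Definition ac_finite_on_unit (R : realType)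
  (mu : {measure set R -> \bar R}) : Prop :=
  (mu (@unit_itv R) < +oo)%E /\
  (fun A => mu (A `&` @unit_itv R)) `<< (@lebesgue_measure R).

(* I : 'I_n -> set R is a partition of [0,1] into n intervals (possibly empty
   or degenerate, in arbitrary order): each I j is an interval, they are
   pairwise disjoint and their union is [0,1]. *)
Definition interval_partition (R : realType) (n : nat) (I : 'I_n -> set R) : Prop :=
  (forall j, is_interval (I j)) /\
  (forall j j', j != j' -> I j `&` I j' = set0) /\
  \bigcup_(j in [set: 'I_n]) I j = @unit_itv R.

(* Union of the intervals with odd (1-based) index, i.e. even 0-based index. *)
Definition odd_union (R : realType) (n : nat) (I : 'I_n -> set R) : set R :=
  \bigcup_(j in [set j : 'I_n | ~~ odd (nat_of_ord j)]) I j.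

(* Union of the intervals with even (1-based) index, i.e. odd 0-based index. *)
Definition even_union (R : realType) (n : nat) (I : 'I_n -> set R) : set R :=
  \bigcup_(j in [set j : 'I_n | odd (nat_of_ord j)]) I j.

(* mu(U_{j odd} I_j) - mu(U_{j even} I_j), as a real number (the measures
   involved are finite). *)
Definition discrepancy (R : realType) (n : nat)
  (mu : {measure set R -> \bar R}) (I : 'I_n -> set R) : R :=
  fine (mu (odd_union I)) - fine (mu (even_union I)).

(* Main.v *)
Require Import Defs.
From HB Require Import structures.
From mathcomp Require Import all_boot all_order all_algebra.
From mathcomp Require Import zify ring lra.
Set Implicit Arguments. Unset Strict Implicit. Unset Printing Implicit Defensive.
Import Order.TTheory GRing.Theory Num.Theory.

(** Cut [0,1] into N equal pieces. A vector u in {+,-,0}^N is read, after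
    twisting its t-th entry by (-1)^t, as a family of sign patterns on the
    pieces, one for each way v of filling its zeros. If u has more than N-n
    sign blocks, then it has fewer than n zeros, and every twisted v has at most
    n blocks, i.e. is a cut into n intervals with alternating signs; the
    discrepancies of different v are then close to each other. For every
    collection let P (resp. Q) be the set of measures whose discrepancy is +max
    (resp. -max) for some v.

    Any antipodal two-colouring of the nonzero vectors in {+,-,0}^N admits a flag
    of N vectors along which the colours alternate (a form of Tucker's lemma,
    proved by counting such flags mod 2). Suppose that for every u with more than
    N-n blocks some collection fails (a) and (b) approximately. Then a colour
    and a rank in 1..N-1 can be given to each u so that the rank is monotone in
    u, and strictly so where the colour changes: use the number of blocks and
    the first sign while there are at most N-n blocks, and the sizes of P and Q
    afterwards. This contradicts the existence of the flag. Finally let N tend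
    to infinity, by compactness of the space of cuts. *)

(** * Alternating flags of sign vectors *)

Section Parity.
Variable T : finType.
Implicit Types (P Q : pred T) (f : T -> bool) (h : T -> T).

Lemma big_addb_flip P Q f h : involutive h ->
  (forall x, P (h x) = P x) -> (forall x, P x -> f (h x) = f x) ->
  (forall x, P x -> Q (h x) = ~~ Q x) ->
  \big[addb/false]_(x | P x && Q x) f x
    = \big[addb/false]_(x | P x && ~~ Q x) f x.
Proof.
move=> hK hP hf hQ; rewrite (reindex_inj (inv_inj hK)).
apply: eq_big => x; first by rewrite hP; case: (boolP (P x)) => //= /hQ ->.
by rewrite hP => /andP[/hf].
Qed.

(** The points [x] and [h x], told apart by [Q], contribute equal terms and cancel modulo 2. *)
Lemma big_addb_invol P Q f h : involutive h ->
  (forall x, P (h x) = P x) -> (forall x, P x -> f (h x) = f x) ->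
  (forall x, P x -> Q (h x) = ~~ Q x) ->
  \big[addb/false]_(x | P x) f x = false.
Proof.
by move=> hK hP hf hQ; rewrite (bigID Q) /= (big_addb_flip hK hP hf hQ) addbb.
Qed.

(* Exactly one point of each [h]-orbit satisfies [A], and likewise [B]. *)
Lemma big_addb_transversal P A B f h : involutive h ->
  (forall x, P (h x) = P x) -> (forall x, P x -> f (h x) = f x) ->
  (forall x, P x -> A (h x) = ~~ A x) -> (forall x, P x -> B (h x) = ~~ B x) ->
  \big[addb/false]_(x | P x && A x) f x = \big[addb/false]_(x | P x && B x) f x.
Proof.
move=> hK hP hf hA hB; rewrite (bigID B) [RHS](bigID A) /=; congr addb.
  by apply: eq_bigl => x; rewrite andbAC.
rewrite (reindex_inj (inv_inj hK)); apply: eq_big => x.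
  rewrite hP; case: (boolP (P x)) => //= Px.
  by rewrite hA // hB // negbK andbC.
by rewrite hP -andbA => /andP[/hf].
Qed.

End Parity.

(** The ordered pairs [(x, y)] and [(y, x)] cancel; [enum_rank] tells them apart. *)
Lemma big_addb_sym (T : finType) (f : T -> T -> bool) : (forall x y, f x y = f y x) ->
  \big[addb/false]_x \big[addb/false]_(y | y != x) f x y = false.
Proof.
move=> fC; rewrite pair_big_dep /=.
pose h (p : T * T) := (p.2, p.1).
apply: (big_addb_invol (h := h) (Q := fun p => (enum_rank p.1 < enum_rank p.2)%N)).
- by case.
- by move=> x; rewrite eq_sym.
- by move=> x _; rewrite fC.
- move=> [x y] /= nxy; rewrite -leqNgt ltn_neqAle; case: eqP => //= /val_inj/enum_rank_inj e.
  by rewrite e eqxx in nxy.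
Qed.

Lemma big_addb_true (T : finType) (P : pred T) :
  \big[addb/false]_(x | P x) true = odd #|P|.
Proof. by rewrite big_const; elim: #|_| => //= k ->. Qed.

(** * Parity of the number of alternating flags *)

Section SignVectors.
Variable N : nat.
Notation sv := {ffun 'I_N -> option bool}.
Implicit Types (x y : sv) (t : 'I_N).

Definition svneg x : sv := [ffun t => omap negb (x t)].
Definition svdel x t : sv := [ffun i => if i == t then None else x i].
Definition svsupp x : {set 'I_N} := [set t | x t].
Definition svflip x t : sv := [ffun i => if i == t then omap negb (x i) else x i].

Lemma svnegK : involutive svneg.
Proof. by move=> x; apply/ffunP => t; rewrite !ffunE; case: (x t) => [[]|]. Qed.

Lemma svflipK t : involutive (svflip^~ t).
Proof.
by move=> x; apply/ffunP => i; rewrite !ffunE; case: eqP => // _; case: (x i) => [[]|].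
Qed.

Lemma isSome_svneg x t : isSome (svneg x t) = isSome (x t).
Proof. by rewrite ffunE; case: (x t). Qed.

Lemma svdel_neg x t : svdel (svneg x) t = svneg (svdel x t).
Proof. by apply/ffunP => i; rewrite !ffunE; case: eqP. Qed.

Lemma svdel_flip x t : svdel (svflip x t) t = svdel x t.
Proof. by apply/ffunP => i; rewrite !ffunE; case: eqP. Qed.

Lemma svdelC x t t' : svdel (svdel x t) t' = svdel (svdel x t') t.
Proof. by apply/ffunP => i; rewrite !ffunE; case: eqP => //; case: eqP. Qed.

Lemma isSome_svdel x t i : isSome (svdel x t i) = (i != t) && isSome (x i).
Proof. by rewrite ffunE; case: eqP. Qed.

Lemma card_svdel x t : x t -> #|svsupp x| = #|svsupp (svdel x t)|.+1.
Proof.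
move=> xt; rewrite (cardsD1 t) inE xt; congr _.+1; apply: eq_card => i.
by rewrite !inE isSome_svdel.
Qed.

Variable s : sv -> bool.
Hypothesis sN : forall x, (0 < #|svsupp x|)%N -> s (svneg x) = ~~ s x.

(* The parity of the number of flags [x_1 < ... < x_p = x] of sign vectors
   along which [s] alternates, where [p] is the size of the support of [x]. *)
Fixpoint flags (p : nat) x : bool :=
  if p is p'.+1 then
    if p' is 0%N then true
    else \big[addb/false]_(t | x t && (s (svdel x t) != s x)) flags p' (svdel x t)
  else false.

Arguments flags : simpl never.

Lemma flagsSS p x : flags p.+2 x =
  \big[addb/false]_(t | x t && (s (svdel x t) != s x)) flags p.+1 (svdel x t).
Proof. by []. Qed.

Lemma flags_neg p x : #|svsupp x| = p -> flags p (svneg x) = flags p x.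
Proof.
elim: p x => [|[|p] IH] x xp //; rewrite !flagsSS.
apply: eq_big => [t|t /andP[xt _]].
  rewrite isSome_svneg svdel_neg; case: (boolP (isSome (x t))) => //= xt.
  move: (card_svdel xt); rewrite xp => -[xp']; rewrite !sN ?xp -?xp' //.
  by case: (s _); case: (s x).
move: xt; rewrite isSome_svneg => /card_svdel; rewrite xp => -[xp'].
by rewrite svdel_neg IH.
Qed.

(** As the total vanishes, the deletions of colour [b] and those of colour [~~ b] have sums of the
    same parity. The colour condition thus no longer depends on [s x]. *)
Lemma flags_eq p x b :
  \big[addb/false]_(t | x t) flags p.+1 (svdel x t) = false ->
  flags p.+2 x = \big[addb/false]_(t | x t && (s (svdel x t) == b)) flags p.+1 (svdel x t).
Proof.
rewrite flagsSS (bigID (fun t => s (svdel x t) == b)) /= => h.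
have {h} := addbI (etrans h (esym (addbb _))).
have [<- -> //|sxb _] := eqVneq (s x) b.
apply: eq_bigl => t; congr andb.
by move: sxb; case: (s (svdel x t)); case: (s x); case: (b).
Qed.

(* By induction, [flags_eq] with [b := true] expands the sum into one over pairs of
   deleted coordinates, where the two orders of deletion cancel. *)
Lemma flags_boundary p x : #|svsupp x| = p.+2 ->
  \big[addb/false]_(t | x t) flags p.+1 (svdel x t) = false.
Proof.
elim: p x => [|p IH] x xp.
  by rewrite big_addb_true -cardsE (_ : [set t | x t] = svsupp x) // xp.
pose f t t' := [&& isSome (x t), isSome (x t'), s (svdel (svdel x t) t') == true
  & flags p.+1 (svdel (svdel x t) t')].
rewrite big_mkcond -[RHS](@big_addb_sym _ f); last first.
  by move=> t t'; rewrite /f svdelC andbCA.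
apply: eq_bigr => t _; case: ifP => [xt|xt]; last by rewrite /f xt big1.
rewrite (flags_eq true); last by apply: IH; move: (card_svdel xt); rewrite xp => -[].
rewrite big_mkcond [RHS]big_mkcond; apply: eq_bigr => t' _.
by rewrite /f xt /= isSome_svdel; case: (t' == t) => //=; case: (isSome _) => //=; case: eqP.
Qed.

Definition svfull q x := [forall t, isSome (x t) == (t < q)%N].

Lemma svfullP q x : reflect (forall t, isSome (x t) = (t < q)%N) (svfull q x).
Proof. by apply: (iffP forallP) => h t; apply/eqP; rewrite h. Qed.

Lemma card_svfull q x : (q <= N)%N -> svfull q x -> #|svsupp x| = q.
Proof.
move=> qN /svfullP xq; rewrite -[RHS]card_ord -(card_image (f := widen_ord qN)).
  apply: eq_card => t; rewrite inE xq; apply/idP/imageP => [tq|[j _ ->]].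
    by exists (Ordinal tq) => //; apply: val_inj.
  exact: (ltn_ord j).
by move=> i j /(congr1 val) /= /val_inj.
Qed.

Lemma svfull_neg q x : svfull q (svneg x) = svfull q x.
Proof. by apply: eq_forallb => t; rewrite isSome_svneg. Qed.

Lemma svneg_Some x t : x t -> (svneg x t == Some true) = (x t != Some true).
Proof. by rewrite ffunE; case: (x t) => [[]|]. Qed.

(** Induction on [q]: after expansion by [flags_eq], only the deletions of the last coordinate
    survive modulo 2, and they give back the previous sum. *)
Lemma flags_full_odd q : (q < N)%N ->
  \big[addb/false]_(x | svfull q.+1 x && s x) flags q.+1 x = true.
Proof.
elim: q => [|q IH] qN; set o := Ordinal qN.
(* Both [s x] and a positive last coordinate select one vector from each antipodal pair, and [flags]
   is constant on the pair. *)
all: rewrite (big_addb_transversal (B := fun x => x o == Some true) svnegK (svfull_neg _)).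
- rewrite (big_pred1 [ffun t => if t == o then Some true else None]) //= => x.
  apply/andP/eqP => [[/svfullP xf /eqP xo]|->]; last first.
    rewrite ffunE eqxx; split=> //; apply/svfullP => t; rewrite ffunE.
    by rewrite -val_eqE /= ltnS leqn0; case: eqP.
  apply/ffunP => t; rewrite ffunE; case: eqP => [->//|/eqP to].
  by have := xf t; rewrite ltnS leqn0 -[_ == 0]/(t == o) (negbTE to); case: (x t).
- by move=> x /(card_svfull qN); apply: flags_neg.
- by move=> x /(card_svfull qN) xq; rewrite sN ?xq.
- by move=> x /svfullP /(_ o) xo; rewrite svneg_Some // xo /=.
- under eq_bigr => x /andP[/(card_svfull qN) xq _].
    rewrite (flags_eq true) ?flags_boundary //; over.
  rewrite (exchange_big_dep xpredT) //= (bigD1 o) //= [X in _ (+) X]big1 ?addbF.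
    rewrite -[RHS](IH (ltnW qN)).
    (* [h'] puts a [+] back at [o], which inverts the deletion of [o]. *)
    pose h' x : sv := [ffun i => if i == o then Some true else x i].
    have h'P x : h' (svdel x o) = x <-> x o = Some true.
      split=> [/ffunP/(_ o)|xo]; first by rewrite !ffunE eqxx.
      by apply/ffunP => t; rewrite !ffunE; case: eqP => // ->.
    rewrite [RHS](reindex_onto (svdel^~ o) h') /=; last first.
      move=> x /andP[/svfullP xf _]; apply/ffunP => t; rewrite !ffunE.
      by case: eqP => // ->; have := xf o; rewrite ltnn; case: (x o).
    apply: eq_bigl => x; rewrite eqb_id; case: (boolP (s _)) => /= _; last by rewrite !andbF.
    rewrite !andbT; apply/andP/andP => [[/andP[/svfullP xf /eqP xo] _]|[/svfullP xf /eqP/h'P xo]].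
      split; last by apply/eqP/h'P.
      apply/svfullP => t; rewrite isSome_svdel xf -val_eqE /=.
      by case: (ltngtP t q.+1) => // h; rewrite ltnS ?(ltnW h) // leqNgt h.
    rewrite xo; split=> //; rewrite eqxx andbT; apply/svfullP => t.
    have [->|to] := eqVneq t o; first by rewrite xo /= ltnS leqnn.
    have := xf t; rewrite isSome_svdel to /= => ->.
    by move: to; rewrite -val_eqE /= [RHS]ltnS [RHS]leq_eqVlt => /negbTE ->.
  (* Flipping coordinate [t] does not change what is left after deleting [t], so these terms cancel
     in pairs. *)
  move=> t to; apply: (big_addb_invol (Q := fun x => x t == Some true) (svflipK t)).
  + move=> x; rewrite svdel_flip; congr (_ && _ && (_ && _)).
    * by apply: eq_forallb => i; rewrite ffunE; case: (i == t); case: (x i).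
    * by rewrite ffunE (eq_sym o) (negbTE to).
    * by rewrite ffunE eqxx; case: (x t).
  + by move=> x _; rewrite svdel_flip.
  + by move=> x /andP[_ /andP[xt _]]; rewrite ffunE eqxx; case: (x t) xt => [[]|].
- by move=> x /(card_svfull qN); apply: flags_neg.
- by move=> x /(card_svfull qN) xq; rewrite sN ?xq.
- by move=> x /svfullP /(_ o) xo; rewrite svneg_Some // xo /=.
Qed.

(* Along a flag alternating in [s], the rank [lev] increases strictly. *)
Lemma alternating_flag_level (lev : sv -> nat) : (0 < N)%N ->
  (forall x, (0 < #|svsupp x|)%N -> (0 < lev x)%N) ->
  (forall x t, x t -> (0 < #|svsupp (svdel x t)|)%N ->
     s (svdel x t) != s x -> (lev (svdel x t) < lev x)%N) ->
  exists x, (N <= lev x)%N.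
Proof.
move=> N0 lev0 levS; have NN : (N.-1 < N)%N by rewrite prednK.
have flev p x : #|svsupp x| = p.+1 -> flags p.+1 x -> (p < lev x)%N.
  elim: p x => [|p IH] x xp; first by move=> _; apply: lev0; rewrite xp.
  rewrite flagsSS => fx.
  have [t /andP[xt /andP[sxt ft]]] :
      exists t, x t && ((s (svdel x t) != s x) && flags p.+1 (svdel x t)).
    apply/existsP; apply: contraLR fx; rewrite negb_exists => /forallP h.
    by rewrite big1 // => t xt; have := h t; rewrite andbA xt /= => /negbTE.
  move: (card_svdel xt); rewrite xp => -[xp'].
  by apply: leq_ltn_trans (IH _ (esym xp') ft) _; apply: levS; rewrite -?xp'.
(* An odd sum has an odd term, so some vector of full support ends an alternating flag. *)
have [x /andP[/andP[xf _] fx]] :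
    exists x, svfull N.-1.+1 x && s x && flags N.-1.+1 x.
  apply/existsP; have := flags_full_odd NN; apply: contraTT; rewrite negb_exists.
  by move=> /forallP h; rewrite big1 // => x xs; have := h x; rewrite xs /= => /negbTE.
by exists x; rewrite -[N]prednK //; apply: flev; rewrite ?(card_svfull NN xf).
Qed.
End SignVectors.

(** * Discrete equalization *)

Local Open Scope ring_scope.

(** * Blocks of Boolean words *)

Fixpoint changes (b : bool) (w : seq bool) : nat :=
  if w is c :: w' then ((b != c) + changes c w')%N else 0%N.

Definition blocks (w : seq bool) : nat :=
  if w is c :: w' then (changes c w').+1 else 0%N.

Lemma changes_trans b c w : (changes b w <= (b != c) + changes c w)%N.
Proof. by case: w => //= d w; case: b; case: c; case: d => /=; lia. Qed.

Lemma changes_subseq b w1 w2 : subseq w1 w2 -> (changes b w1 <= changes b w2)%N.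
Proof.
elim: w2 w1 b => [|y w2 IH] [|x w1] b //=; case: eqP => [-> /IH le12|_ /IH le12].
  by rewrite leq_add2l.
apply: leq_trans (changes_trans b y (x :: w1)) _.
by rewrite leq_add2l; apply: le12.
Qed.

(** Expresses [blocks] through the changes seen from any letter put in front, to which
    [changes_subseq] applies. *)
Lemma blocks_head w b : (0 < size w)%N -> blocks w = (changes b w + (head b w == b))%N.
Proof. by case: w => //= c w _; rewrite eq_sym; case: (b == c) => /=; lia. Qed.

Lemma blocks_subseq w1 w2 : subseq w1 w2 -> (blocks w1 <= blocks w2)%N.
Proof.
case: w1 => // x w1 sub.
have w2_gt0 : (0 < size w2)%N by apply: leq_trans (size_subseq sub).
rewrite (blocks_head x w2_gt0) (@blocks_head (x :: w1) (~~ x)) //=.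
have := @changes_subseq x _ _ sub; rewrite /= eqxx.
have := @changes_subseq (~~ x) _ _ sub; rewrite /=.
case: w2 sub w2_gt0 => // y w2 _ _ /=; case: x; case: y => /=; lia.
Qed.

(** Put the first letter of [w2] in front of both words: the changes then number all blocks of [w1],
    but one less than the blocks of [w2]. *)
Lemma blocks_subseq_lt w1 w2 b : subseq w1 w2 -> (0 < size w1)%N ->
  head b w1 != head b w2 -> (blocks w1 < blocks w2)%N.
Proof.
case: w1 => // x w1; case: w2 => // y w2 sub _ /= xy.
have /= := @changes_subseq y _ _ sub.
by rewrite eqxx eq_sym xy !add1n.
Qed.

Lemma blocks_map_negb w : blocks [seq ~~ b | b <- w] = blocks w.
Proof.
case: w => //= c w; congr _.+1; elim: w c => //= d w IH c.
by rewrite IH; case: c; case: d.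
Qed.

Lemma blocks_size w : (blocks w <= size w)%N.
Proof.
case: w => //= c w; rewrite ltnS; elim: w c => //= d w IH c.
by have := IH d; case: (c != d) => /=; lia.
Qed.

Lemma pmap_subseq (T : Type) (U : eqType) (f g : T -> option U) (e : seq T) :
  (forall i, f i = None \/ f i = g i) -> subseq (pmap f e) (pmap g e).
Proof.
move=> fg; elim: e => //= i e IH; have [->|->] := fg i => /=.
  by case: (g i) => //= c; apply: subseq_trans IH (subseq_cons _ _).
by case: (g i) => //= c; rewrite eqxx.
Qed.

(** * Imbalance of two finite sets *)

Section Imbalance.
Variable T : finType.
Implicit Types P Q : {set T}.

(* Plays the role of the length of a longest alternating sequence in Ky Fan's
   lemma. *)
Definition imb_level P Q : nat := ((minn #|P| #|Q|).*2 + (#|P| != #|Q|))%N.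

(* In a tie any antipodal choice will do, since a larger pair of sets on the same
   even level is the same pair. *)
Definition imb_sign P Q : bool :=
  if #|P| == #|Q| then (if [pick a in P :|: Q] is Some a then a \in P else true)
  else (#|Q| < #|P|)%N.

Lemma imb_level_sub P Q P' Q' : P \subset P' -> Q \subset Q' ->
  (imb_level P Q <= imb_level P' Q')%N.
Proof.
move=> /subset_leq_card leP /subset_leq_card leQ; rewrite /imb_level; lia.
Qed.

(** At an odd level the smaller set keeps its size, so the larger side stays larger; at an even
    level neither set can grow. *)
Lemma imb_sign_sub P Q P' Q' : P \subset P' -> Q \subset Q' ->
  imb_level P Q = imb_level P' Q' -> imb_sign P Q = imb_sign P' Q'.
Proof.
move=> subP subQ.
have leP := subset_leq_card subP; have leQ := subset_leq_card subQ.
rewrite /imb_level /imb_sign; case: (eqVneq #|P| #|Q|) => [PQ|PQ] e.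
  have PP' : P = P' by apply/eqP; rewrite eqEcard subP /=; lia.
  have QQ' : Q = Q' by apply/eqP; rewrite eqEcard subQ /=; lia.
  by rewrite -PP' -QQ' PQ eqxx.
by case: eqP => ?; lia.
Qed.

Lemma imb_levelC P Q : imb_level Q P = imb_level P Q.
Proof. by rewrite /imb_level minnC eq_sym. Qed.

Lemma imb_signC P Q : P :&: Q = set0 -> P :|: Q != set0 ->
  imb_sign Q P = ~~ imb_sign P Q.
Proof.
move=> PQ0 PQ; rewrite /imb_sign eq_sym setUC; case: ifP => [_|]; last by lia.
case: pickP => [a|PQ']; last first.
  by case/eqP: PQ; apply/setP => a; rewrite PQ' inE.
have : a \notin P :&: Q by rewrite PQ0 inE.
by rewrite !inE; case: (a \in P); case: (a \in Q).
Qed.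

Lemma imb_level_gt0 P Q : P :|: Q != set0 -> (0 < imb_level P Q)%N.
Proof.
move=> PQ; rewrite /imb_level; case: (posnP #|P|); last by lia.
move/eqP; rewrite cards_eq0 => /eqP P0.
case: (posnP #|Q|); last by lia.
by move/eqP; rewrite cards_eq0 => /eqP Q0; rewrite P0 Q0 setU0 eqxx in PQ.
Qed.

(** Turns a level into the counts of alternative (b); the parity term of [imb_level] accounts for
    odd [k]. *)
Lemma imb_level_ge P Q k : (k <= imb_level P Q)%N ->
  [/\ (k <= #|P| + #|Q|)%N, (k./2 <= #|P|)%N & (k./2 <= #|Q|)%N].
Proof. by rewrite /imb_level => h; split; lia. Qed.
End Imbalance.

(** * Colours and ranks of sign vectors *)

Section Discrete.
Variables (R : realDomainType) (m n N : nat) (s k : 'I_m -> nat).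
Variable D : forall i : 'I_m, 'I_(s i) -> {ffun 'I_N -> bool} -> R.
Notation sv := {ffun 'I_N -> option bool}.
Notation fv := {ffun 'I_N -> bool}.
Implicit Types (u : sv) (v : fv).

Definition completes u v := [forall t, (u t == None) || (u t == Some (v t))].
Definition svseq u : seq bool := pmap u (enum 'I_N).
Definition maxabs i v : R := \big[Num.max/0]_(a < s i) `|D a v|.
Definition topP u i := [set a : 'I_(s i) | [exists v, completes u v && (D a v == maxabs i v)]].
Definition topN u i := [set a : 'I_(s i) | [exists v, completes u v && (D a v == - maxabs i v)]].
(* A measure lying in both sets forces the whole collection to be nearly halved. *)
Definition balanced u i := (s i == 0)%N || (topP u i :&: topN u i != set0).
(** The cap [k i] lets the hypothesis on the sum of the [k i] bound the total level; a balanced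
    collection counts as settled and gets the full value. *)
Definition level u i : nat :=
  if balanced u i then k i else minn (k i) (imb_level (topP u i) (topN u i)).

Hypothesis DN : forall i (a : 'I_(s i)) v, D a [ffun t => ~~ v t] = - D a v.
Hypothesis n_gt0 : (0 < n)%N.
Hypothesis nN : (n <= N)%N.
Hypothesis k_gt0 : forall i, (0 < k i)%N.
Hypothesis sum_k : (\sum_(i < m) k i = m + n - 1)%N.

Let negv v : fv := [ffun t => ~~ v t].

Lemma negvK : involutive negv.
Proof. by move=> v; apply/ffunP => t; rewrite !ffunE negbK. Qed.

Lemma completesN u v : completes (svneg u) (negv v) = completes u v.
Proof.
by apply: eq_forallb => t; rewrite !ffunE; case: (u t) => [[]|] //=; case: (v t).
Qed.

Lemma maxabsN i v : maxabs i (negv v) = maxabs i v.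
Proof. by apply: eq_bigr => a _; rewrite DN normrN. Qed.

Lemma topP_neg u i : topP (svneg u) i = topN u i.
Proof.
apply/setP => a; rewrite !inE; apply/existsP/existsP => -[v]; last first.
  by exists (negv v); rewrite completesN maxabsN DN eqr_oppLR.
by exists (negv v); rewrite -completesN negvK maxabsN DN eqr_opp.
Qed.

Lemma topN_neg u i : topN (svneg u) i = topP u i.
Proof. by rewrite -{2}(svnegK u) topP_neg. Qed.

Lemma completes_ex u : completes u [ffun t => odflt true (u t)].
Proof. by apply/forallP => t; rewrite ffunE; case: (u t) => //= b; rewrite eqxx orbT. Qed.

(** At any one completion of [u], a measure attaining the maximum falls on the side given by the
    sign of its discrepancy. *)
Lemma top_neq0 u i : (0 < s i)%N -> topP u i :|: topN u i != set0.
Proof.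
move=> si; pose a0 := Ordinal si.
set v : fv := [ffun t => odflt true (u t)].
have [a _ ea] : {a | a \in 'I_(s i) & maxabs i v = `|D a v|}.
  by apply: (eq_bigmax a0) => // a _; exact: normr_ge0.
apply/set0Pn; exists a; rewrite !inE; apply/orP.
have [D0|D0] := ger0P (D a v); [left|right]; apply/existsP; exists v.
  by rewrite completes_ex ea (ger0_norm D0) /=.
by rewrite completes_ex ea (ltr0_norm D0) opprK /=.
Qed.

Lemma svdel_completes u t v : completes u v -> completes (svdel u t) v.
Proof. by move=> /forallP h; apply/forallP => j; rewrite ffunE; case: (j == t) => //=; exact: h. Qed.

(** Deleting a coordinate only adds completions. *)
Lemma topP_del u t i : topP u i \subset topP (svdel u t) i.
Proof.
apply/subsetP => a; rewrite !inE => /existsP[v /andP[uv Da]]; apply/existsP.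
by exists v; rewrite svdel_completes.
Qed.

Lemma topN_del u t i : topN u i \subset topN (svdel u t) i.
Proof.
apply/subsetP => a; rewrite !inE => /existsP[v /andP[uv Da]]; apply/existsP.
by exists v; rewrite svdel_completes.
Qed.

Lemma balanced_del u t i : balanced u i -> balanced (svdel u t) i.
Proof.
rewrite /balanced; case: eqP => //= _; apply: contra => /eqP e.
by rewrite -subset0 -e setISS ?topP_del ?topN_del.
Qed.

Lemma balancedN u i : balanced (svneg u) i = balanced u i.
Proof. by rewrite /balanced topP_neg topN_neg setIC. Qed.

Lemma level_del u t i : (level u i <= level (svdel u t) i)%N.
Proof.
rewrite /level; have := @balanced_del u t i; case: (balanced u i) => [-> //|_].
have := imb_level_sub (topP_del u t i) (topN_del u t i).
by case: ifP => _; lia.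
Qed.

Lemma levelN u i : level (svneg u) i = level u i.
Proof. by rewrite /level balancedN topP_neg topN_neg imb_levelC. Qed.

Lemma level_bounds u i : (0 < level u i <= k i)%N.
Proof.
rewrite /level; case: ifP => [_|]; first by rewrite k_gt0 leqnn.
rewrite /balanced => /norP[si _]; rewrite geq_minl leq_min k_gt0 imb_level_gt0 //.
by rewrite top_neq0 // lt0n.
Qed.

Lemma svseqN u : svseq (svneg u) = [seq ~~ b | b <- svseq u].
Proof.
rewrite /svseq; elim: (enum _) => //= t e ->.
by rewrite ffunE; case: (u t).
Qed.

Lemma svseq_del u t : subseq (svseq (svdel u t)) (svseq u).
Proof. by apply: pmap_subseq => i; rewrite ffunE; case: eqP; [left|right]. Qed.

Lemma size_svseq u : size (svseq u) = #|svsupp u|.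
Proof.
rewrite /svseq size_pmap cardE [in RHS]/enum_mem size_filter -enumT.
by apply: eq_count => t; rewrite -[RHS]/(t \in svsupp u) inE; case: (u t).
Qed.

Let sgn u : bool :=
  if (blocks (svseq u) <= N - n)%N then head true (svseq u)
  else if [pick i | level u i < k i]%N is Some i
       then imb_sign (topP u i) (topN u i) else true.

(** Levels fall as [u] grows, hence the subtraction. While some collection is unsettled their sum
    lies in [m]..[m + n - 2], so the second case takes values in [N - n + 1]..[N - 1]. *)
Let rank u : nat :=
  if (blocks (svseq u) <= N - n)%N then blocks (svseq u)
  else ((N - n).+1 + (m + n - 2 - \sum_(i < m) level u i))%N.

Lemma discrete_equalization : exists u,
  (N - n < blocks (svseq u))%N /\ (forall i, level u i = k i).
Proof.
suff : [exists u, (N - n < blocks (svseq u))%N && [forall i, level u i == k i]].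
  by move=> /existsP[u /andP[? /forallP h]]; exists u; split=> // i; apply/eqP.
apply: contraT => /existsPn none.
have undone u : (N - n < blocks (svseq u))%N -> exists i, (level u i < k i)%N.
  move=> ub; have := none u; rewrite ub /= => /forallPn[i lik]; exists i.
  by have := level_bounds u i; lia.
have sum_lt u : (N - n < blocks (svseq u))%N ->
    (m <= \sum_(i < m) level u i < m + n - 1)%N.
  move=> /undone[j lj].
  rewrite -{1}(card_ord m) -sum1_card leq_sum => [|i _]; last by case/andP: (level_bounds u i).
  suff : (\sum_(i < m) level u i < \sum_(i < m) k i)%N by rewrite sum_k; lia.
  rewrite (bigD1 j) //= [X in (_ < X)%N](bigD1 j) //= -addSn leq_add //.
  by apply: leq_sum => i _; case/andP: (level_bounds u i).
have [] := @alternating_flag_level N sgn _ rank (leq_trans n_gt0 nN).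
- move=> u u0; rewrite /sgn svseqN blocks_map_negb; case: ifP => ub.
    by case: (svseq u) (size_svseq u) => [e|//]; rewrite -e in u0.
  under eq_pick => i do rewrite levelN.
  case: pickP => [i li|none_i].
    (* The collection picked is not balanced, so its two sets are disjoint and not both empty, and
       [imb_signC] applies. *)
    rewrite topP_neg topN_neg; move: li; rewrite /level.
    case: ifP => [_|/norP[si /negPn/eqP PQ] _]; first by rewrite ltnn.
    by rewrite imb_signC // top_neq0 // lt0n.
  have [|i] := undone u; first by rewrite ltnNge ub.
  by rewrite none_i.
- move=> u u0; rewrite /rank; case: ifP => // _.
  by move: u0; rewrite -size_svseq; case: (svseq u).
- move=> u t ut u0; rewrite /sgn /rank.
  have sub := svseq_del u t.
  have := blocks_subseq sub.
  case: ifP => yb; case: ifP => xb le_b.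
  + by move=> hd; apply: (blocks_subseq_lt sub _ hd); rewrite size_svseq.
  + by move=> _; lia.
  + by lia.
  have leif : (\sum_(i < m) level u i <= \sum_(i < m) level (svdel u t) i
      ?= iff [forall i, level u i == level (svdel u t) i])%N.
    apply: leqif_sum => i _; split=> //; exact: level_del.
  have /andP[m1 m2] : (m <= \sum_(i < m) level u i < m + n - 1)%N.
    by apply: sum_lt; rewrite ltnNge xb.
  have /andP[m3 m4] : (m <= \sum_(i < m) level (svdel u t) i < m + n - 1)%N.
    by apply: sum_lt; rewrite ltnNge yb.
  move=> sg; suff : (\sum_(i < m) level u i < \sum_(i < m) level (svdel u t) i)%N by lia.
  (* If the sums agreed, all levels would agree, the same collection would be picked, and
     [imb_sign_sub] would give equal colours. *)
  rewrite ltn_neqAle leif.1 andbT leif.2; apply: contra sg => /forallP eql.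
  have -> : [pick i | (level (svdel u t) i < k i)%N] = [pick i | (level u i < k i)%N].
    by apply: eq_pick => i /=; rewrite (eqP (eql i)).
  apply/eqP; case: pickP => // i li; symmetry.
  have e := eqP (eql i); have li' := li; rewrite e in li'.
  move: li li' e; rewrite /level.
  case: ifP => [_|_]; first by rewrite ltnn.
  case: ifP => [_|_]; first by rewrite ltnn.
  move=> l1 l2 e; apply: imb_sign_sub (topP_del _ _ _) (topN_del _ _ _) _.
  by lia.
- move=> u; rewrite /rank; case: ifP => ub; first by lia.
have := sum_lt u; rewrite ltnNge ub => /(_ isT).
  by lia.
Qed.
End Discrete.

(** * From sign vectors to cuts *)

Lemma changes_nth b w :
  changes b w = (\sum_(r < size w) (nth b (b :: w) r != nth b w r))%N.
Proof.
elim: w b => [|c w IH] b /=; first by rewrite big_ord0.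
rewrite big_ord_recl /= IH; congr (_ + _)%N; apply: eq_bigr => -[r rw] _ /=.
rewrite (set_nth_default c b rw); congr (nat_of_bool (_ != _)).
by apply: set_nth_default; rewrite /= ltnW.
Qed.

(** * Runs of a sign pattern and their end points *)

Section Cuts.
Variables (N : nat) (w : nat -> bool).

Definition nchanges t : nat := \sum_(r < t) (w r != w r.+1).
(** Piece [t] lies in run number [nchanges t], counted from 0. By monotonicity [cut j] is the grid
    point where run [j] starts, or [N] if there is no such run. *)
Definition cut j : nat := \sum_(t < N) (nchanges t < j)%N.

Lemma nchangesS t : nchanges t.+1 = (nchanges t + (w t != w t.+1))%N.
Proof. by rewrite /nchanges big_ord_recr. Qed.

Lemma leq_nchanges t t' : (t <= t')%N -> (nchanges t <= nchanges t')%N.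
Proof.
move=> /subnKC <-; elim: (t' - t)%N => [|d IH]; first by rewrite addn0.
by rewrite addnS nchangesS (leq_trans IH) // leq_addr.
Qed.

Lemma odd_nchanges t : w t = w 0%N (+) odd (nchanges t).
Proof.
elim: t => [|t IH]; first by rewrite /nchanges big_ord0 addbF.
by rewrite nchangesS oddD oddb addbA -IH; case: (w t); case: (w t.+1).
Qed.

Lemma cut0 : cut 0 = 0%N.
Proof. by rewrite /cut big1. Qed.

Lemma cut_full n : (forall t, (t < N)%N -> (nchanges t < n)%N) -> cut n = N.
Proof.
by move=> h; rewrite /cut; under eq_bigr => t _ do rewrite h //; rewrite sum1_card card_ord.
Qed.

Lemma leq_cut j j' : (j <= j')%N -> (cut j <= cut j')%N.
Proof.
by move=> jj'; apply: leq_sum => t _; case: ltnP => // /leq_trans ->.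
Qed.
End Cuts.

(** * Alternating sums over cut points *)

Section AltSum.
Variable R : realDomainType.

Definition alt_sum n (x : nat -> R) : R := \sum_(j < n) (-1) ^+ j * (x j.+1 - x j).

(** The indicators mark an initial segment of the pieces, so the sum telescopes. *)
Lemma cut_telescope N w j (H : nat -> R) :
  H (cut N w j) - H 0%N = \sum_(t < N) (nchanges w t < j)%N%:R * (H t.+1 - H t).
Proof.
elim: N => [|N IH]; first by rewrite /cut !big_ord0 subrr.
rewrite big_ord_recr /= -IH /cut big_ord_recr /= -/(cut N w j).
case: ltnP => h; last by rewrite mul0r addr0 addn0.
have -> : cut N w j = N.
  by apply: cut_full => t tN; apply: leq_ltn_trans h; rewrite leq_nchanges // ltnW.
by rewrite mul1r addn1; ring.
Qed.

(** Group the pieces by runs: on run [j] the sign is [(-1) ^+ w 0] times [(-1) ^+ j]. *)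
Lemma alt_sum_cut N n w (H : nat -> R) :
  (forall t, (t < N)%N -> (nchanges w t < n)%N) ->
  \sum_(t < N) (-1) ^+ w t * (H t.+1 - H t) = (-1) ^+ w 0%N * alt_sum n (H \o cut N w).
Proof.
move=> hn; rewrite /alt_sum.
have E j : (H \o cut N w) j.+1 - (H \o cut N w) j
    = \sum_(t < N) (nchanges w t == j)%:R * (H t.+1 - H t).
  rewrite -[LHS](subrKA (H 0%N)) -[X in _ + X]opprB !cut_telescope -sumrB.
  apply: eq_bigr => t _; rewrite -mulrBl; congr (_ * _).
  by rewrite ltnS leq_eqVlt; case: ltngtP => //=; rewrite ?subrr ?subr0.
under [in RHS]eq_bigr => j _ do rewrite E mulr_sumr.
rewrite exchange_big mulr_sumr; apply: eq_bigr => -[t tN] _ /=.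
rewrite (bigD1 (Ordinal (hn t tN))) //= eqxx mul1r big1 ?addr0; last first.
  move=> j; rewrite -val_eqE eq_sym /= => /negbTE ->; by rewrite mul0r mulr0.
by rewrite mulrA [in LHS](odd_nchanges w t) signr_addb signr_odd.
Qed.
End AltSum.

(** The union is counted because [P :|: Q] becomes the set of measures in alternative (b). *)
Definition equalizing (T : finType) (kappa : nat) (P Q : {set T}) : bool :=
  [&& kappa <= #|P :|: Q|, kappa./2 <= #|P| & kappa./2 <= #|Q|]%N.

Lemma equalizingC (T : finType) kappa (P Q : {set T}) :
  equalizing kappa Q P = equalizing kappa P Q.
Proof. by rewrite /equalizing setUC; congr andb; rewrite andbC. Qed.

(** * Approximate equalization on a grid *)

Section Approx.
Variables (R : realDomainType) (m n N : nat) (s k : 'I_m -> nat).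
Variable H : forall i : 'I_m, 'I_(s i) -> nat -> R.
Variable d : R.
Hypothesis d_ge0 : 0 <= d.
Hypothesis Hd : forall i (a : 'I_(s i)) t, (t < N)%N -> `|H a t.+1 - H a t| <= d.
Hypothesis n_gt0 : (0 < n)%N.
Hypothesis nN : (n <= N)%N.
Hypothesis k_gt0 : forall i, (0 < k i)%N.
Hypothesis sum_k : (\sum_(i < m) k i = m + n - 1)%N.
Notation sv := {ffun 'I_N -> option bool}.
Notation fv := {ffun 'I_N -> bool}.
Implicit Types (u : sv) (v : fv).

(* The twist by [(-1)^t] turns many sign changes of [v] into few sign changes of
   the pattern of signs on the pieces. *)
Let D i (a : 'I_(s i)) (v : fv) : R :=
  \sum_(t < N) (-1) ^+ (v t (+) odd t) * (H a t.+1 - H a t).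

Lemma twisted_sumN i (a : 'I_(s i)) v : D a ([ffun t => ~~ v t] : fv) = - D a v.
Proof.
rewrite /D -sumrN; apply: eq_bigr => t _; rewrite ffunE -mulNr; congr (_ * _).
by rewrite addNb; case: (_ (+) _); rewrite /= ?expr0 ?expr1 ?opprK.
Qed.

(** The completions differ only at zeros of [u]. There are fewer than [n] of them, and each changes
    the sum by at most [d *+ 2]. *)
Lemma twisted_sum_close i (a : 'I_(s i)) u v v' :
  (N - n < blocks (svseq u))%N -> completes u v -> completes u v' ->
  `|D a v - D a v'| <= n%:R * (d *+ 2).
Proof.
move=> ub /forallP uv /forallP uv'; rewrite /D -sumrB.
apply: le_trans (ler_norm_sum _ _ _) _.
apply: (@le_trans _ _ (\sum_(t < N) (~~ isSome (u t))%:R * (d *+ 2))).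
  apply: ler_sum => t _; rewrite -mulrBl normrM.
  have := uv t; have := uv' t; case: (u t) => [b|] /=.
    by move=> /eqP[<-] /eqP[<-]; rewrite subrr normr0 !mul0r.
  move=> _ _; rewrite mul1r -mulr_natl ler_pM //; last exact: Hd.
  apply: le_trans (ler_normB _ _) _; rewrite !normrX normrN1 !expr1n; lra.
rewrite -mulr_suml; apply: ler_wpM2r; first by rewrite mulrn_wge0 ?d_ge0.
rewrite -natr_sum ler_nat.
have := blocks_size (svseq u); rewrite size_svseq.
have : (\sum_(t < N) ~~ isSome (u t) + #|svsupp u| = N)%N.
  rewrite -[RHS]card_ord -[RHS]sum1_card -sum1_card [X in (_ + X)%N]big_mkcond -big_split /=.
  by apply: eq_bigr => t _; rewrite inE; case: (u t).
by move: ub nN; move: #|_| (\sum_(_ < _) _)%N (blocks _); lia.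
Qed.

Lemma bigmax_close (I : finType) (f g : I -> R) e :
  0 <= e -> (forall i, `|f i - g i| <= e) ->
  \big[Num.max/0]_i `|f i| <= \big[Num.max/0]_i `|g i| + e.
Proof.
move=> e0 fg; apply: bigmax_le => [|i _].
  by rewrite addr_ge0 // bigmax_ge_id.
have -> : f i = g i + (f i - g i) by ring.
apply: le_trans (ler_normD _ _) _; apply: lerD => //.
exact: (le_bigmax _ (fun i => `|g i|)).
Qed.

(** Between consecutive pieces exactly one of [v] and its twist changes sign. Of the [N - 1] places
    [v] uses at least [N - n], which leaves at most [n - 1] to the twist. *)
Lemma changes_completed u v : completes u v -> (N - n < blocks (svseq u))%N ->
  forall t, (t < N)%N ->
  (nchanges (fun r => nth false [seq v t | t <- enum 'I_N] r (+) odd r) t < n)%N.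
Proof.
move=> /forallP uv ub; set vs := [seq v t | t <- enum 'I_N].
have size_vs : size vs = N by rewrite size_map size_enum_ord.
have sub : subseq (svseq u) vs.
  rewrite /vs (_ : map _ _ = pmap (Some \o v) (enum 'I_N)); last first.
    by elim: (enum _) => //= t e ->.
  by apply: pmap_subseq => t; case/orP: (uv t) => /eqP ->; [left|right].
move: (leq_trans ub (blocks_subseq sub)) size_vs; clear sub.
move: vs => -[|c vs] //=; rewrite ltnS changes_nth => Nb Nvs.
suff h : (nchanges (fun r => nth false (c :: vs) r (+) odd r) (size vs) < n)%N.
  by move=> t tN; apply: leq_ltn_trans h; apply: leq_nchanges; rewrite -ltnS Nvs.
have : (nchanges (fun r => nth false (c :: vs) r (+) odd r) (size vs) +
     \sum_(r < size vs) (nth c (c :: vs) r != nth c vs r) = size vs)%N.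
  rewrite -[RHS]card_ord -sum1_card -big_split /=; apply: eq_bigr => -[r rvs] _ /=.
  rewrite (set_nth_default c false rvs) (@set_nth_default _ _ c false r) //; last by rewrite /= ltnW.
  by case: (nth c vs r); case: (nth c (c :: vs) r); case: (odd r).
by lia.
Qed.
Lemma discrete_approx : exists c : nat -> nat,
  [/\ c 0%N = 0%N, c n = N, {homo c : j j' / (j <= j')%N} &
  forall i, let A a := alt_sum n (@H i a \o c) in
    let M := \big[Num.max/0]_(a < s i) `|A a| in
    M <= n%:R * (d *+ 2) *+ 2 \/
    exists P Q : {set 'I_(s i)}, [/\ equalizing (k i) P Q,
      forall a, a \in P -> `|A a - M| <= n%:R * (d *+ 2) *+ 2 &
      forall a, a \in Q -> `|A a + M| <= n%:R * (d *+ 2) *+ 2]].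
Proof.
have [u [ub ul]] := @discrete_equalization _ _ _ _ _ _ D twisted_sumN n_gt0 nN k_gt0 sum_k.
set v0 : fv := [ffun t => odflt true (u t)].
have uv0 : completes u v0 := completes_ex u.
set w := fun r => nth false [seq v0 t | t <- enum 'I_N] r (+) odd r.
have wn := changes_completed uv0 ub.
exists (cut N w); split; first exact: cut0.
- exact: cut_full.
- by move=> j j'; apply: leq_cut.
set e := n%:R * (d *+ 2).
have e0 : 0 <= e by rewrite mulr_ge0 ?mulrn_wge0.
move=> i A M.
have DA a : D a v0 = (-1) ^+ w 0%N * A a.
  rewrite /A -(alt_sum_cut _ wn); apply: eq_bigr => t _.
  by rewrite (nth_map t) ?size_enum_ord ?nth_ord_enum.
have MD : M = maxabs D i v0.
  by apply: eq_bigr => a _; rewrite DA normrM normrX normrN1 expr1n mul1r.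
have close v : completes u v -> `|maxabs D i v - M| <= e.
  move=> uv; rewrite MD ler_distl lerBlDr; apply/andP; split.
    by apply: bigmax_close => // a; apply: (twisted_sum_close a ub).
  by apply: bigmax_close => // a; apply: (twisted_sum_close a ub).
(* One [e] pays for passing from [v] to [v0] in [D], the other for the same passage in the
   maximum. *)
have nearP a : a \in topP D u i -> `|D a v0 - M| <= e *+ 2.
  rewrite inE => /existsP[v /andP[uv /eqP Dv]].
  have := twisted_sum_close a ub uv0 uv; have := close _ uv; rewrite -Dv -/e.
  by rewrite !ler_norml; lra.
have nearN a : a \in topN D u i -> `|D a v0 + M| <= e *+ 2.
  rewrite inE => /existsP[v /andP[uv /eqP Dv]].
  have := twisted_sum_close a ub uv0 uv; have := close _ uv; rewrite -/e.
  by rewrite !ler_norml; lra.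
have := ul i; rewrite /level; case: ifP => [bal _|/negbT/norP[_ /negPn/eqP PQ] lev].
  left; case/orP: bal => [/eqP s0|/set0Pn[a]].
    by apply: bigmax_le => [|[a a_lt]]; [rewrite mulrn_wge0|exfalso; rewrite s0 in a_lt].
  (* One value within [e *+ 2] of both [M] and [- M] forces [M <= e *+ 2]. *)
  rewrite inE => /andP[/nearP + /nearN]; rewrite !ler_norml; lra.
right; have eqz : equalizing (k i) (topP D u i) (topN D u i).
  have [|kPQ kP kQ] := @imb_level_ge _ (topP D u i) (topN D u i) (k i); first by lia.
  by rewrite /equalizing cardsU PQ cards0 subn0 kPQ kP kQ.
(* If the first run is negative, [A] is the opposite of [D] at [v0] and the two sets exchange
   roles. *)
case w0 : (w 0%N) DA => DA.
  exists (topN D u i), (topP D u i); split; first by rewrite equalizingC.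
    by move=> a /nearN; rewrite DA expr1 mulN1r -normrN opprD opprK.
  by move=> a /nearP; rewrite DA expr1 mulN1r -normrN opprB opprK addrC.
exists (topP D u i), (topN D u i); split=> //.
  by move=> a /nearP; rewrite DA expr0 mul1r.
by move=> a /nearN; rewrite DA expr0 mul1r.
Qed.
End Approx.

(** * Passage to the limit *)

From mathcomp Require Import all_classical all_reals all_analysis.
Import numFieldNormedType.Exports.
Local Open Scope classical_set_scope.
Local Open Scope ring_scope.

(** * Continuity of finite sums, maxima and minima *)

Section ContinuousBigop.
Variables (T : topologicalType) (R : realType) (I : Type).
Implicit Types (r : seq I) (P : pred I) (f : I -> T -> R).

Lemma continuous_sumr r P f :
  (forall i, continuous (f i)) ->
  continuous (fun x => \sum_(i <- r | P i) f i x : R).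
Proof.
move=> cf; elim: r => [|i r IH]; first by under eq_fun do rewrite big_nil; exact: cst_continuous.
under eq_fun do rewrite big_cons; case: (P i) => // x.
by apply: cvgD; [exact: cf|exact: IH].
Qed.

Lemma continuous_bigmaxr r P f (f0 : T -> R) : continuous f0 ->
  (forall i, continuous (f i)) ->
  continuous (fun x => \big[Num.max/f0 x]_(i <- r | P i) f i x : R).
Proof.
move=> cf0 cf; elim: r => [|i r IH]; first by under eq_fun do rewrite big_nil; exact: cf0.
under eq_fun do rewrite big_cons; case: (P i) => // x.
by apply: (@continuous_max _ _ (f i)); [exact: cf|exact: IH].
Qed.

Lemma continuous_bigminr r P f (f0 : T -> R) : continuous f0 ->
  (forall i, continuous (f i)) ->
  continuous (fun x => \big[Num.min/f0 x]_(i <- r | P i) f i x : R).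
Proof.
move=> cf0 cf; elim: r => [|i r IH]; first by under eq_fun do rewrite big_nil; exact: cf0.
under eq_fun do rewrite big_cons; case: (P i) => // x.
by apply: (@continuous_min _ _ (f i)); [exact: cf|exact: IH].
Qed.

End ContinuousBigop.

Section ContinuousOps.
Variables (T : topologicalType) (R : realType).

Lemma continuous_alt_sum n (g : nat -> T -> R) : (forall j, continuous (g j)) ->
  continuous (fun x => alt_sum n (g^~ x) : R).
Proof.
move=> cg; rewrite /alt_sum; apply: continuous_sumr => j x; apply: cvgM; first exact: cvg_cst.
by apply: cvgB; exact: cg.
Qed.

Lemma continuous_norm_fun (f : T -> R) : continuous f -> continuous (fun x => `|f x|).
Proof. by move=> cf x; apply: cvg_norm; exact: cf. Qed.

Lemma continuous_addr (f g : T -> R) : continuous f -> continuous g ->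
  continuous (fun x => f x + g x).
Proof. by move=> cf cg x; apply: cvgD; [exact: cf|exact: cg]. Qed.

Lemma continuous_subr (f g : T -> R) : continuous f -> continuous g ->
  continuous (fun x => f x - g x).
Proof. by move=> cf cg x; apply: cvgB; [exact: cf|exact: cg]. Qed.
End ContinuousOps.

Lemma bigmin_eq_or disp (T : orderType disp) (I : Type) (r : seq I) (P : pred I)
    (f : I -> T) (x : T) :
  \big[Order.min/x]_(i <- r | P i) f i = x \/
  exists2 i, P i & \big[Order.min/x]_(i <- r | P i) f i = f i.
Proof.
elim: r => [|i r IH]; first by left; rewrite big_nil.
rewrite big_cons; case: (boolP (P i)) => // Pi.
rewrite minEle; case: ifP => _; first by right; exists i.
exact: IH.
Qed.

Lemma closed_le_fun (T : topologicalType) (R : realType) (f g : T -> R) :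
  continuous f -> continuous g -> closed [set x | f x <= g x].
Proof.
move=> cf cg; rewrite (_ : [set x | _] = (fun x => g x - f x) @^-1` [set y | 0 <= y]).
  apply: preimage_closed; last exact: closed_ge.
  by move=> x _; apply: cvgB; [exact: cg|exact: cf].
by apply/seteqP; split => x /=; rewrite subr_ge0.
Qed.

(** Uniform continuity on [[0, 1]], from the near-covering form of compactness: near each centre,
    both values are compared with the value of [G] at the centre. *)
Lemma grid_oscillation (R : realType) (G : R -> R) (d : R) :
  continuous G -> 0 < d ->
  \forall N \near \oo, forall t, (t < N)%N ->
    `|G (t.+1%:R / N%:R) - G (t%:R / N%:R)| <= d.
Proof.
move=> cG d0.
have [|M _ HM] := (@compact_near_coveringP R^o `[0%R, 1%R]).1 (@segment_compact R 0 1)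
    nat \oo (fun N x => `|G (x + N.+1%:R^-1) - G x| <= d) _.
  move=> x _; have /cvgrPdist_le/(_ _ (divr_gt0 d0 (ltr0Sn R 1))) := cG x.
  move=> /nbhs_ballP[_/posnumP[e] xe].
  have e2 : 0 < e%:num / 2 by [].
  have shift (a b z : R) : `|a - b| < e%:num / 2 -> 0 < z < e%:num / 2 ->
    `|a - (b + z)| < e%:num by rewrite !ltr_norml; lra.
  exists (ball (x : R) (e%:num / 2), [set N | N.+1%:R^-1 < e%:num / 2]).
    split; first exact: nbhsx_ballx.
    exact: (near_infty_natSinv_lt (PosNum e2)).
  move=> [y N] [/= xy Ne].
  have N0 : 0 < (N.+1%:R^-1 : R) by rewrite invr_gt0.
  have h1 : `|G x - G y| <= d / 2.
    by apply: xe; move: xy; rewrite /ball /= !ltr_norml; lra.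
  have h2 : `|G x - G (y + N.+1%:R^-1)| <= d / 2.
    by apply: xe; apply: shift xy _; rewrite N0.
  by move: h1 h2; rewrite !ler_norml; lra.
exists M.+1 => // -[//|N] /= MN t tN.
have t01 : `[0%R, 1%R]%classic (t%:R / N.+1%:R : R).
  rewrite /= in_itv /= divr_ge0 //= ler_pdivrMr ?ltr0n // mul1r ler_nat.
  by rewrite ltnW.
have -> : t.+1%:R / N.+1%:R = t%:R / N.+1%:R + N.+1%:R^-1 :> R.
  by rewrite -[X in _ + X]mul1r -mulrDl natr1.
exact: HM N MN _ t01.
Qed.

(** * Exact equalization for continuous functions *)

Section ContinuousEqualization.
Variables (R : realType) (m n : nat) (s k : 'I_m -> nat).
Variable G : forall i : 'I_m, 'I_(s i) -> R -> R.
Hypothesis cG : forall i (a : 'I_(s i)), continuous (G a).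
Hypothesis n_gt0 : (0 < n)%N.
Hypothesis k_gt0 : forall i, (0 < k i)%N.
Hypothesis sum_k : (\sum_(i < m) k i = m + n - 1)%N.

(** Meaningful for [j <= n] only; beyond that [inord] returns index 0. *)
Let pt (x : 'rV[R]_n.+1) (j : nat) : R := x ord0 (inord j).
Let A i (a : 'I_(s i)) x : R := alt_sum n (G a \o pt x).
Let Mx i x : R := \big[Num.max/0]_(a < s i) `|A a x|.
Let err i (p : {set 'I_(s i)} * {set 'I_(s i)}) x : R :=
  \sum_(a in p.1) `|A a x - Mx i x| + \sum_(a in p.2) `|A a x + Mx i x|.
(* Vanishes exactly at the cuts where the collection [i] satisfies (a) or (b). *)
Let defect i x : R :=
  \big[Num.min/Mx i x]_(p : {set 'I_(s i)} * {set 'I_(s i)}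
      | equalizing (k i) p.1 p.2) err p x.
(** The equations at both ends are split into inequalities so that [closed_le_fun] handles every
    condition. *)
Let cuts : set 'rV[R]_n.+1 :=
  [set x | [/\ pt x 0 <= 0, 0 <= pt x 0, pt x n <= 1, 1 <= pt x n
    & forall j, (j < n)%N -> pt x j <= pt x j.+1]].

Lemma pt_continuous j : continuous (pt^~ j).
Proof. exact: coord_continuous. Qed.

Lemma A_continuous i (a : 'I_(s i)) : continuous (A a).
Proof.
apply: (@continuous_alt_sum _ _ n (fun j x => G a (pt x j))) => j x.
by apply: (continuous_comp (@pt_continuous j x)); exact: cG.
Qed.

Lemma Mx_continuous i : continuous (Mx i).
Proof.
apply: continuous_bigmaxr => [|a]; first exact: cst_continuous.
exact/continuous_norm_fun/A_continuous.
Qed.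

Lemma defect_continuous i : continuous (defect i).
Proof.
apply: continuous_bigminr => [|p]; first exact: Mx_continuous.
apply: continuous_addr; apply: continuous_sumr => a; apply: continuous_norm_fun.
  by apply: continuous_subr; [exact: A_continuous|exact: Mx_continuous].
by apply: continuous_addr; [exact: A_continuous|exact: Mx_continuous].
Qed.

Lemma Mx_ge0 i x : 0 <= Mx i x.
Proof. exact: bigmax_ge_id. Qed.

Lemma err_ge0 i (p : {set 'I_(s i)} * {set 'I_(s i)}) x : 0 <= err p x.
Proof. by rewrite addr_ge0 // sumr_ge0. Qed.

Lemma defect_ge0 i x : 0 <= defect i x.
Proof.
rewrite /defect; elim/big_ind: _ => [|y z y0 z0|p _]; first exact: Mx_ge0.
  by rewrite le_min y0.
exact: err_ge0.
Qed.

Lemma pt_le x : cuts x -> forall j j', (j <= j' <= n)%N -> pt x j <= pt x j'.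
Proof.
move=> [_ _ _ _ h] j j' /andP[/subnKC <-]; elim: (j' - j)%N => [|d IH].
  by rewrite addn0.
by rewrite addnS => jn; apply: le_trans (h _ jn); apply: IH; exact: ltnW.
Qed.

Lemma compact_cuts : compact cuts.
Proof.
apply: (subclosed_compact (B := [set x : 'rV[R]_n.+1 | forall i, `[0%R, 1%R]%classic (x ord0 i)])).
- rewrite (_ : cuts = [set x | pt x 0 <= 0] `&` [set x | 0 <= pt x 0]
     `&` [set x | pt x n <= 1] `&` [set x | 1 <= pt x n]
     `&` \bigcap_(j in [set j | (j < n)%N]) [set x | pt x j <= pt x j.+1]).
    have cst (e : R) : continuous (fun _ : 'rV[R]_n.+1 => e) by exact: cst_continuous.
    apply: closedI; last first.
      apply: closed_bigI => j _.
      exact: closed_le_fun (@pt_continuous j) (@pt_continuous j.+1).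
    apply: closedI; last exact: closed_le_fun (cst 1) (@pt_continuous n).
    apply: closedI; last exact: closed_le_fun (@pt_continuous n) (cst 1).
    apply: closedI; last exact: closed_le_fun (cst 0) (@pt_continuous 0%N).
    exact: closed_le_fun (@pt_continuous 0%N) (cst 0).
  apply/seteqP; split => x; first by case.
  by move=> [[[[? ?] ?] ?] h]; split => // j jn; exact: h.
- exact: (@rV_compact R n.+1 (fun=> `[0%R, 1%R]%classic) (fun=> @segment_compact R 0 1)).
- move=> x cx i /=; rewrite in_itv /=; have [_ x0 xn _ _] := cx.
  have -> : x ord0 i = pt x i by rewrite /pt inord_val.
  by rewrite (le_trans x0) ?(le_trans _ xn) ?pt_le ?leqnn ?leq_ord.
Qed.


Lemma small_defect e : 0 < e -> exists2 x, cuts x & forall i, defect i x <= e.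
Proof.
(* The grid error is [4 * n * d], and [err] has at most [2 * s i] terms of that size; the summand 1
   covers alternative (a) and keeps [C] positive. *)
move=> e0; pose C := (n * 4 * (1 + 2 * \sum_(i < m) s i))%N.
have C0 : 0 < C%:R :> R by rewrite ltr0n /C; lia.
pose d : R := e / C%:R; have d0 : 0 < d by rewrite divr_gt0.
have [M _ HM] : \forall N \near \oo, forall i (a : 'I_(s i)) t, (t < N)%N ->
    `|G a (t.+1%:R / N%:R) - G a (t%:R / N%:R)| <= d.
  apply: filter_forall => i; apply: filter_forall => a.
  exact: grid_oscillation.
pose N := maxn M n; have N_gt0 : (0 < N)%N by rewrite leq_max n_gt0 orbT.
have [c [c0 cn cle happrox]] := @discrete_approx R m n N s k
  (fun i a t => G a (t%:R / N%:R)) d (ltW d0) (HM N (leq_maxl _ _))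
  n_gt0 (leq_maxr _ _) k_gt0 sum_k.
pose x : 'rV[R]_n.+1 := \row_j ((c j)%:R / N%:R).
have ptx j : (j <= n)%N -> pt x j = (c j)%:R / N%:R.
  by move=> jn; rewrite /pt mxE inordK.
have Ax i (a : 'I_(s i)) : A a x = alt_sum n ((fun t => G a (t%:R / N%:R)) \o c).
  by apply: eq_bigr => j _; rewrite /= !ptx // ltnW.
have Mxx i : Mx i x = \big[Num.max/0]_(a < s i) `|alt_sum n ((fun t => G a (t%:R / N%:R)) \o c)|.
  by apply: eq_bigr => a _; rewrite Ax.
have NN : N%:R / N%:R = 1 :> R by rewrite divff // pnatr_eq0 -lt0n.
exists x.
  split; rewrite ?ptx // ?c0 ?cn ?NN ?mul0r // => j jn.
  by rewrite !ptx ?(ltnW jn) // ler_pM2r ?invr_gt0 ?ltr0n // ler_nat cle.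
move=> i; set E := n%:R * (d *+ 2) *+ 2 in happrox.
have E0 : 0 <= E by rewrite mulrn_wge0 // mulr_ge0 // mulrn_wge0 // ltW.
have Ee : E * (1 + 2 * s i)%:R <= e.
  have -> : e = E * (1 + 2 * \sum_(i < m) s i)%:R.
    have -> : e = d * C%:R by rewrite /d divfK // gt_eqF.
    by rewrite /E /C !natrM !natrD; ring.
  by rewrite ler_wpM2l // ler_nat leq_add2l leq_mul2l (bigD1 i) //= leq_addr.
apply: le_trans Ee; have /= := happrox i; rewrite -Mxx => -[MxE|[P [Q [eqz hP hQ]]]].
  apply: le_trans (bigmin_le_id _ _ _ _) _; apply: le_trans MxE _.
  by rewrite ler_peMr // ler1n.
apply: (bigmin_inf (P, Q)) => //.
rewrite natrD natrM mulrDr mulr1 mulrCA; apply: le_trans (_ : E * (s i)%:R + E * (s i)%:R <= _); last lra.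
have sumE (B : {set 'I_(s i)}) (f : 'I_(s i) -> R) : (forall a, a \in B -> f a <= E) ->
    \sum_(a in B) f a <= E * (s i)%:R.
  move=> hf; apply: (@le_trans _ _ (\sum_(a in B) E)); first exact: ler_sum.
  by rewrite sumr_const -[leLHS]mulr_natr ler_wpM2l // ler_nat -[leqRHS]card_ord max_card.
by apply: lerD; apply: sumE => a; rewrite Ax; [exact: hP|exact: hQ].
Qed.

(** The total defect attains its minimum on the compact set of cuts. By [small_defect] this minimum
    is 0, so one cut serves all collections. *)
Lemma continuous_equalization : exists c : nat -> R,
  [/\ c 0%N = 0, c n = 1, forall j j', (j <= j' <= n)%N -> c j <= c j' &
  forall i, let A a := alt_sum n (@G i a \o c) in
    let M := \big[Num.max/0]_(a < s i) `|A a| in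
    M = 0 \/
    exists P Q : {set 'I_(s i)}, [/\ equalizing (k i) P Q,
      forall a, a \in P -> A a = M & forall a, a \in Q -> A a = - M]].
Proof.
have [x0 cx0 _] := small_defect ltr01.
have [||x /[!inE] cx xmin] := @EVT_min_rV R _ (fun x => \sum_i defect i x) cuts _ compact_cuts _.
- by exists x0.
- by apply: continuous_subspaceT; apply: continuous_sumr => i; exact: defect_continuous.
exists (pt x); split.
- by apply/eqP; case: cx => *; rewrite eq_le; apply/andP.
- by apply/eqP; case: cx => *; rewrite eq_le; apply/andP.
- exact: pt_le.
move=> i A' M.
have d0 : defect i x = 0.
  apply/eqP; rewrite eq_le defect_ge0 andbT; apply/ler_addgt0Pr => e e0; rewrite add0r.
  have [y cy ysmall] := small_defect (divr_gt0 e0 (ltr0Sn R m)).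
  apply: (@le_trans _ _ (\sum_j defect j x)).
    by rewrite (bigD1 i) //= lerDl sumr_ge0 // => j _; exact: defect_ge0.
  apply: le_trans (xmin y _) _; first by rewrite inE.
  apply: (@le_trans _ _ (\sum_(j < m) (e / m.+1%:R))); first exact: ler_sum.
  rewrite sumr_const card_ord -[leLHS]mulr_natr -mulrA ler_piMr ?(ltW e0) //.
  by rewrite mulrC ler_pdivrMr ?ltr0n // mul1r ler_nat.
have := bigmin_eq_or (index_enum _) (fun p : {set 'I_(s i)} * {set 'I_(s i)} =>
  equalizing (k i) p.1 p.2) (fun p => err p x) (Mx i x).
rewrite -/(defect i x) d0 => -[M0|[[P Q] eqz /esym/eqP]]; first by left.
rewrite paddr_eq0 ?sumr_ge0 // !psumr_eq0 // => /andP[/allP hP /allP hQ].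
right; exists P, Q; split=> // a.
  have := hP a (mem_index_enum a); rewrite normr_eq0 subr_eq0 => /implyP h /h.
  by move/eqP.
have := hQ a (mem_index_enum a); rewrite normr_eq0 addr_eq0 => /implyP h /h.
by move/eqP.
Qed.
End ContinuousEqualization.

(** * Measures *)

Lemma measurable_unit_itv (R : realType) : measurable (@unit_itv R : set R).
Proof. exact: measurable_itv. Qed.

(** * Distribution functions of measures *)

Section Distribution.
Variables (R : realType) (mu : {measure set R -> \bar R}).
Hypothesis ac_mu : ac_finite_on_unit mu.
Let U := @unit_itv R.

(** Half-open, so that adjacent slices are disjoint and glue exactly. *)
Definition slice (a b : R) : set R := U `&` `[a, b[.
Definition distribution (x : R) : R := fine (mu (slice 0 x)).

Lemma measurable_slice a b : measurable (slice a b).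
Proof. by apply: measurableI; exact: measurable_itv. Qed.

Lemma slice_fin a b : mu (slice a b) \is a fin_num.
Proof.
rewrite ge0_fin_numE //; apply: le_lt_trans ac_mu.1.
apply: le_measure; rewrite ?inE; [exact: measurable_slice|exact: measurable_unit_itv|].
exact: subIsetl.
Qed.

Lemma slice_measure a b : a <= b ->
  mu (slice a b) = (distribution b - distribution a)%:E.
Proof.
move=> ab; have sliceU : slice 0 b = slice 0 a `|` slice a b.
  apply/seteqP; split=> y; rewrite /slice /U /unit_itv /= !in_itv /=.
    by move=> [/andP[y0 y1] /andP[_ yb]]; case: (ltP y a) => ya; [left|right]; lra.
  by move=> [] [/andP[y0 y1] /andP[ya yb]]; split; lra.
have disj : slice 0 a `&` slice a b = set0.
  apply/seteqP; split=> y //; rewrite /slice /= !in_itv /=.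
  by move=> [[_ /andP[_ h]] [_ /andP[h' _]]]; move: h; rewrite ltNge h'.
rewrite EFinB /distribution !fineK ?slice_fin // sliceU measureU //; try exact: measurable_slice.
by rewrite [X in _ = (X - _)%E]addeC addeK ?slice_fin.
Qed.

Lemma distribution_le a b : a <= b -> distribution a <= distribution b.
Proof.
by move=> ab; rewrite -subr_ge0 -lee_fin -slice_measure.
Qed.

(** The slices around [x] shrink to at most the point [x], which is null by absolute continuity;
    continuity from above and monotonicity conclude. *)
Lemma distribution_continuous : continuous distribution.
Proof.
move=> x; apply/cvgrPdist_le => e e0.
pose B n := slice (x - n.+1%:R^-1) (x + n.+1%:R^-1).
have capB : \bigcap_n B n = U `&` [set x].
  apply/seteqP; split=> [y h|y [Uy /= yx] n _]; last first.
    rewrite yx in Uy *; split=> //=.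
    rewrite in_itv /= lerBlDr lerDl invr_ge0 ltrDl invr_gt0 ltr0n.
    by apply/andP.
  split; first by have [] := h 0%N I.
  apply/eqP; rewrite -subr_eq0 -normr_eq0; apply/eqP/le_anti/andP; split=> //.
  apply/ler_addgt0Pr => d d0; rewrite add0r.
  have [p _ /(_ p (leqnn p)) hp] := near_infty_natSinv_lt (PosNum d0).
  have {}hp : p.+1%:R^-1 < d := hp.
  have [_ /=] := h p I; rewrite in_itv /= => /andP[h1 h2].
  have dist_le (z u v w : R) : w < z -> u - w <= v -> v < u + w -> - z <= v - u <= z by lra.
  by rewrite ler_norml; exact: dist_le hp h1 h2.
have : (mu \o B) n @[n --> \oo] --> mu (\bigcap_n B n).
  apply: nonincreasing_cvg_mu.
  - by rewrite ltey_eq slice_fin.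
  - by move=> n; exact: measurable_slice.
  - by rewrite capB; apply: measurableI; [exact: measurable_unit_itv|exact: measurable_set1].
  - move=> p q pq; apply/subsetPset => y [Uy /=]; rewrite !in_itv /= => /andP[h1 h2].
    have pq' : q.+1%:R^-1 <= p.+1%:R^-1 :> R by rewrite lef_pV2 ?posrE // ler_nat.
    have widen (u v a b : R) : b <= a -> u - b <= v -> v < u + b -> u - a <= v < u + a by lra.
    by split=> //=; rewrite in_itv /=; exact: widen pq' h1 h2.
have -> : mu (\bigcap_n B n) = 0%:E.
  rewrite capB setIC; apply: ((null_content_dominatesP _ _).1 ac_mu.2 [set x]).
    exact: measurable_set1.
  exact: lebesgue_measure_set1.
move=> /fine_cvgP[_ /cvgrPdist_le/(_ e e0)[n _ /(_ n (leqnn n))]] /=.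
rewrite sub0r normrN /B slice_measure /=; last first.
  by rewrite lerD2l; apply: (@le_trans _ _ 0); rewrite ?oppr_le0 invr_ge0.
move=> Bn; near=> y.
have /andP[y1 y2] : x - n.+1%:R^-1 <= y <= x + n.+1%:R^-1.
  rewrite -ler_distlC; near: y.
  by apply: cvgr_dist_le; [exact: cvg_id|rewrite invr_gt0].
have := Bn; have := distribution_le y1; have := distribution_le y2.
have x1 : x - n.+1%:R^-1 <= x by rewrite lerBlDr lerDl invr_ge0.
have x2 : x <= x + n.+1%:R^-1 by rewrite lerDl invr_ge0.
have := distribution_le x1; have := distribution_le x2.
by rewrite !ler_norml; lra.
Unshelve. all: by end_near. Qed.
End Distribution.

(** * Partition of the unit interval into slices *)

Section Slices.
Variables (R : realType) (n : nat) (b : nat -> R).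
Hypothesis b_le : forall j j', (j <= j' <= n)%N -> b j <= b j'.

Definition slices (j : 'I_n) : set R := slice (b j) (b j.+1).

Lemma slices_trivIset : trivIset setT slices.
Proof.
move=> j j' _ _ [y [[_ /=]]]; rewrite in_itv /= => /andP[j1 j2] [_ /=].
rewrite in_itv /= => /andP[j1' j2']; apply: val_inj; apply/eqP.
have lt_b (p q : 'I_n) : b p <= y -> y < b q.+1 -> (p <= q)%N.
  move=> py yq; rewrite leqNgt; apply/negP => qp.
  have := b_le (j := q.+1) (j' := p); rewrite qp ltnW // => /(_ isT) h.
  by have := lt_le_trans yq (le_trans h py); rewrite ltxx.
by rewrite eqn_leq !lt_b.
Qed.

(** A point belongs to the slice that ends at the first cut beyond it. The strict bound [1 < b n]
    provides such a cut for the endpoint 1 too. *)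
Lemma slices_partition : b 0%N = 0 -> 1 < b n -> interval_partition slices.
Proof.
move=> b0 bn; split; last split.
- move=> j x y; rewrite /slices /slice /unit_itv /= !in_itv /=.
  move=> [/andP[x0 _] /andP[xj _]] [/andP[_ y1] /andP[_ yj]] z /andP[xz zy].
  split; rewrite in_itv /=; first by rewrite (le_trans x0 xz) (le_trans zy y1).
  by rewrite (le_trans xj xz) (le_lt_trans zy yj).
- move=> j j' jj'; apply/seteqP; split=> y // [yj yj'].
  by move/eqP: jj'; apply; apply: slices_trivIset => //; exists y.
- apply/seteqP; split=> y; first by move=> [j _ []].
  move=> Uy; have := Uy; rewrite /unit_itv /= in_itv /= => /andP[y0 y1].
  have ex : exists j, y < b j by exists n; apply: le_lt_trans bn.
  case: (ex_minnP ex) => -[|j] yj minj.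
    by move: yj; rewrite b0 ltNge y0.
  have jn : (j < n)%N by apply: minj; apply: le_lt_trans bn.
  exists (Ordinal jn) => //; split=> //=; rewrite in_itv /= yj andbT leNgt.
  by apply/negP => /minj; rewrite ltnn.
Qed.

Variable mu : {measure set R -> \bar R}.
Hypothesis ac_mu : ac_finite_on_unit mu.

Lemma measure_slices (P : pred 'I_n) :
  mu (\bigcup_(j in [set j | P j]) slices j) =
  (\sum_(j < n | P j) (distribution mu (b j.+1) - distribution mu (b j)))%:E.
Proof.
have -> : [set j | P j] = [set j | (j \in index_enum 'I_n) && P j].
  by apply/seteqP; split=> j /=; rewrite mem_index_enum.
rewrite bigcup_seq_cond measure_bigsetU_ord; last exact: slices_trivIset.
  rewrite -sumEFin; apply: eq_bigr => j _; apply: (slice_measure ac_mu).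
  by apply: b_le; rewrite leqnSn ltn_ord.
by move=> j; exact: measurable_slice.
Qed.

Lemma discrepancy_slices :
  discrepancy mu slices = alt_sum n (distribution mu \o b).
Proof.
rewrite /discrepancy /odd_union /even_union !measure_slices /=.
rewrite /alt_sum [RHS](bigID (fun j : 'I_n => ~~ odd j)) /=; congr (_ + _).
  by apply: eq_bigr => j jP; rewrite -signr_odd (negbTE jP) expr0 mul1r.
rewrite -sumrN; apply: eq_big => [j|j jP]; first by rewrite negbK.
by rewrite -signr_odd jP expr1 mulN1r.
Qed.

(** [discrepancy] compares [fine] values; both measures are finite by [measure_slices], so equality
    lifts to the extended reals. *)
Lemma slices_equal : discrepancy mu slices = 0 ->
  mu (odd_union slices) = mu (even_union slices).
Proof.
rewrite /discrepancy /odd_union /even_union !measure_slices /= => /eqP.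
by rewrite subr_eq0 => /eqP ->.
Qed.
End Slices.

Theorem theorem3p4 (R : realType) (m n : nat)
  (s : 'I_m -> nat)
  (M : forall i : 'I_m, 'I_(s i) -> {measure set R -> \bar R})
  (k : 'I_m -> nat) :
  (forall i, injective (M i)) ->
  (forall i (a : 'I_(s i)), ac_finite_on_unit (M i a)) ->
  (0 < n)%N ->
  (forall i, 0 < k i)%N ->
  (\sum_(i < m) k i)%N = (m + n - 1)%N ->
  exists I : 'I_n -> set R,
    interval_partition I /\
    forall i : 'I_m,
      (forall a : 'I_(s i), (M i a) (odd_union I) = (M i a) (even_union I))
      \/
      (let Mx := \big[Num.max/0]_(a < s i) `|discrepancy (M i a) I| in
       exists S : {set 'I_(s i)},
         (k i <= #|S|)%N /\
         (forall a, a \in S -> discrepancy (M i a) I = Mx \/ discrepancy (M i a) I = - Mx) /\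
         ((k i)./2 <= #|[set a in S | discrepancy (M i a) I == Mx]|)%N /\
         ((k i)./2 <= #|[set a in S | discrepancy (M i a) I == - Mx]|)%N).
Proof.
move=> _ acM n_gt0 k_gt0 sum_k.
have cG i (a : 'I_(s i)) : continuous (fun x : R => distribution (M i a) (2 * x)).
  move=> x; apply: (continuous_comp (f := *%R (2 : R))); last exact: distribution_continuous.
  exact: mulrl_continuous.
have [c [c0 cn c_le ceq]] := continuous_equalization cG n_gt0 k_gt0 sum_k.
(* The factor 2 makes the half-open slices cover the endpoint 1. *)
pose b j : R := 2 * c j.
have b_le j j' : (j <= j' <= n)%N -> b j <= b j'.
  by move=> /c_le jj'; rewrite ler_wpM2l.
exists (@slices R n b); split.
  by apply: slices_partition => //; rewrite /b ?c0 ?mulr0 // cn; lra.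
move=> i; have discE (a : 'I_(s i)) : discrepancy (M i a) (@slices R n b) =
    alt_sum n ((fun x => distribution (M i a) (2 * x)) \o c).
  exact: (@discrepancy_slices _ _ _ b_le _ (acM i a)).
pose Mc := \big[Num.max/0]_(a < s i)
  `|alt_sum n ((fun x => distribution (M i a) (2 * x)) \o c)|.
have MxE : \big[Num.max/0]_(a < s i) `|discrepancy (M i a) (@slices R n b)| = Mc.
  by apply: eq_bigr => a _; rewrite discE.
have /= [M0|[P [Q [/and3P[kPQ kP kQ] hP hQ]]]] := ceq i; [left|right].
  move=> a; apply: slices_equal => //; apply/eqP.
  rewrite -normr_le0 -[leRHS](etrans MxE M0).
  exact: (le_bigmax _ (fun a => `|discrepancy (M i a) (@slices R n b)|)).
rewrite MxE; exists (P :|: Q); split=> //; split.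
  by move=> a; rewrite inE discE => /orP[/hP|/hQ]; [left|right].
split.
  apply: leq_trans kP _; apply: subset_leq_card; apply/fintype.subsetP => a aP.
  by rewrite !inE aP discE hP /=.
apply: leq_trans kQ _; apply: subset_leq_card; apply/fintype.subsetP => a aQ.
by rewrite !inE aQ orbT discE hQ /=.
Qed.
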